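(* Let $\mathcal{P}$ be a partition of $\omega$ into infinitely many infinite sets and let $\mathcal{A}$ be a completely separable $NMAD$-family on $\omega$ of size $\mathfrak{c}$. Then there is an infinite set $X\subseteq 2^{\omega}$ such that $\mathcal{F}_{\mathcal{P}}$, $S_{\mathcal{A}}$ and $S_{\mathcal{A}_X}$ form an $RK$-antichain, i.e. they are pairwise $RK$-incomparable.
   Context: All filters are proper free filters on $\omega$ (they contain all cofinite sets). $A\subseteq^* B$ means $A\setminus B$ is finite. An $AD$-family is an infinite family of infinite subsets of $\omega$ any two distinct members of which have finite intersection. For an $AD$-family $\mathcal{A}$, $\mathcal{I}(\mathcal{A})=\{X\subseteq\omega:\exists\text{ finite }\mathcal{A}'\subseteq\mathcal{A}\ (X\subseteq^*\bigcup\mathcal{A}')\}$ and $S_{\mathcal{A}}=\{\omega\setminus I:I\in\mathcal{I}(\mathcal{A})\}$. An $AD$-family $\mathcal{A}$ is an $NMAD$-family (nowhere $MAD$) if every $X\subseteq\omega$ with $X\notin\mathcal{I}(\mathcal{A})$ contains an infinite set $B$ such that $B\cap I$ is finite for every $I\in\mathcal{I}(\mathcal{A})$. $\mathcal{A}^*$ is the set of infinite $M\subseteq\omega$ for which $\{A\in\mathcal{A}:|A\cap M|=\omega\}$ is infinite; $\mathcal{A}$ is completely separable if for every $M\in\mathcal{A}^*$ there is $A\in\mathcal{A}$ with $A\subseteq M$. $\mathcal{F}_{\mathcal{P}}=\{F\subseteq\omega:\forall P\in\mathcal{P}\ (P\subseteq^* F)\}$ (the FAN-filter). For $x\in 2^{\omega}$,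 $A_x=\{x|n:n<\omega\}\subseteq 2^{<\omega}=\bigcup_n 2^n$; for infinite $X\subseteq 2^{\omega}$, $\mathcal{A}_X=\{A_x:x\in X\}$, regarded as an $AD$-family on $\omega$ by identifying $2^{<\omega}$ with $\omega$ via a fixed bijection. $\mathcal{F}\leq_{RK}\mathcal{G}$ means there is a surjection $f:\omega\to\omega$ with $\mathcal{F}=\{X\subseteq\omega:f^{-1}(X)\in\mathcal{G}\}$. $\mathcal{F}$ and $\mathcal{G}$ are $RK$-incomparable if neither $\mathcal{F}\leq_{RK}\mathcal{G}$ nor $\mathcal{G}\leq_{RK}\mathcal{F}$. *)

(* Defs.v *)
From mathcomp Require Import all_boot.
From mathcomp Require Import boolp classical_sets functions cardinality.

Set Implicit Arguments.
Unset Strict Implicit.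
Unset Printing Implicit Defensive.

Local Open Scope classical_set_scope.

Definition almost_subset (A B : set nat) : Prop := finite_set (A `\` B).

Definition AD_family (A : set (set nat)) : Prop :=
  [/\ infinite_set A,
      forall a, A a -> infinite_set a
    & forall a b, A a -> A b -> a <> b -> finite_set (a `&` b)].

(* The ideal I(A) generated by A and the finite sets. *)
Definition AD_ideal (A : set (set nat)) : set (set nat) :=
  [set X | exists A' : set (set nat),
     [/\ finite_set A', A' `<=` A & almost_subset X (\bigcup_(a in A') a)]].

(* The filter S_A dual to I(A). *)
Definition AD_filter (A : set (set nat)) : set (set nat) :=
  [set ~` I | I in AD_ideal A].

Definition NMAD_family (A : set (set nat)) : Prop :=
  AD_family A /\
  forall X : set nat, ~ AD_ideal A X ->
    exists B : set nat,
      [/\ infinite_set B, B `<=` X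
        & forall I, AD_ideal A I -> finite_set (B `&` I)].

Definition AD_star (A : set (set nat)) : set (set nat) :=
  [set M | infinite_set M /\
           infinite_set [set a | A a /\ infinite_set (a `&` M)]].

Definition completely_separable (A : set (set nat)) : Prop :=
  forall M, AD_star A M -> exists2 a, A a & a `<=` M.

Definition partition_into_infinite_sets (P : set (set nat)) : Prop :=
  [/\ partition P id [set: nat],
      infinite_set P
    & forall p, P p -> infinite_set p].

Definition FAN_filter (P : set (set nat)) : set (set nat) :=
  [set F | forall p, P p -> almost_subset p F].

(* [mkseq x n] is the restriction x|n, so the range is the branch A_x of the
   binary tree, the nodes of which are the finite sequences of booleans. *)
Definition branch (x : nat -> bool) : set (seq bool) := range (mkseq x).

(* A_X, transported to omega along an identification e of 2^{<omega} with
   omega. *)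
Definition branch_family (e : seq bool -> nat) (X : set (nat -> bool)) :
    set (set nat) :=
  [set e @` branch x | x in X].

Definition RK_le (F G : set (set nat)) : Prop :=
  exists f : nat -> nat,
    set_surj [set: nat] [set: nat] f /\ F = [set X | G (f @^-1` X)].

Definition RK_incomparable (F G : set (set nat)) : Prop :=
  ~ RK_le F G /\ ~ RK_le G F.

(* Main.v *)
(* For every AD family A, neither of F_P and S_A is below the other (diagonal
   arguments), so it remains to choose X so that S_A and S_{A_X} are incomparable.
   - If f witnesses S_{A_X} <= S_A, then X = {x : f^{-1}(A_x) in I(A)}, so each
     f rules out one X only.
   - If f witnesses S_A <= S_{A_X}, let D(a), for a in A, be the finite set of
     the branches that meet f^{-1}(a) in an infinite set.  For every finite
     set L of branches only finitely many a satisfy D(a) <= L: otherwise remove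
     finite parts of these a so that the preimage of their union M lies within
     the branches of L; then M is in I(A) but meets infinitely many a.  Hence X
     contains the union E_f of the D(a), which has size continuum.
   A transfinite recursion chooses distinct points s(f,0), s(f,1), s(f,2), for
   all f, in E_f (or anywhere, if E_f is small).  Leaving out all s(f,2), and
   deciding s(f,0) against the one X that f rules out, excludes every f. *)

Require Import Defs.
From mathcomp Require Import all_boot.
From mathcomp Require Import boolp classical_sets functions cardinality.
From mathcomp Require wochoice.

Set Implicit Arguments.
Unset Strict Implicit.
Unset Printing Implicit Defensive.

Local Open Scope classical_set_scope.

(** * Well-orders and recursion along them *)

Lemma strict_well_order (W : eqType) :
  exists lt : W -> W -> Prop,
    [/\ well_founded lt, forall x y z, lt x y -> lt y z -> lt x z
      & forall x y, [\/ lt x y, x = y | lt y x]].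
Proof.
have [R Rwo] := wochoice.well_ordering_principle W.
have Rwc : wochoice.wo_chain R predT by move=> B _; exact: Rwo.
have Rtot x y : R x y || R y x by exact: wochoice.wo_chainW Rwc _ _ _ _.
have Ranti x y : R x y -> R y x -> x = y.
  move=> Rxy Ryx.
  by apply: (wochoice.wo_chain_antisymmetric Rwc); rewrite // Rxy Ryx.
have minR (B : pred W) x : B x -> exists2 z, B z & forall y, B y -> R z y.
  move=> Bx; have [|z [[Bz zmin] _]] := Rwo B; first by exists x.
  by exists z => // y By; exact: zmin.
(* Transitivity is read off from the least element of [{x, y, z}]. *)
have Rtr x y z : R x y -> R y z -> R x z.
  move=> Rxy Ryz.
  have [|t] := minR [pred t | [|| t == x, t == y | t == z]] x.
    by rewrite /= eqxx.
  move=> /or3P[] /eqP-> tmin.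
  - by apply: tmin; rewrite /= eqxx !orbT.
  - have Ryx : R y x by apply: tmin; rewrite /= eqxx.
    by rewrite (Ranti _ _ Rxy Ryx).
  - have Rzy : R z y by apply: tmin; rewrite /= eqxx orbT.
    by rewrite -(Ranti _ _ Ryz Rzy).
exists (fun x y => ~~ R y x); split.
- move=> x; apply: contrapT => nx.
  have [|z /asboolP nz zmin] :=
    minR (fun x => `[< ~ Acc (fun x y => ~~ R y x) x >]) x.
    exact/asboolP.
  apply: nz; constructor => y; apply: contraNP => ny; apply: zmin.
  exact/asboolP.
- move=> x y z nyx nzy; apply: contra nyx => Rzx.
  by apply: Rtr _ Rzx; case/orP: (Rtot y z) => // Rzy; rewrite Rzy in nzy.
- move=> x y; have [Rxy|] := boolP (R x y); last by constructor 3.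
  have [Ryx|] := boolP (R y x); last by constructor 1.
  by constructor 2; apply: Ranti.
Qed.

Lemma well_founded_minimum (W : Type) (lt : W -> W -> Prop) (S : set W) :
  well_founded lt -> S !=set0 ->
  exists2 x, S x & forall y, lt y x -> ~ S y.
Proof.
move=> ltwf [x]; elim/(well_founded_ind ltwf): x => x IH Sx.
have [[y [yx Sy]]|nex] := pselect (exists y, lt y x /\ S y); first exact: IH Sy.
by exists x => // y yx Sy; apply: nex; exists y.
Qed.

(** Greedy recursion: [w] takes a point of [E w] not taken below it. Covering is excluded for every
    [s], hence for the one under construction, so [point] never serves as a fallback. *)
Lemma well_founded_choice (W : Type) (T : pointedType) (lt : W -> W -> Prop)
    (E : W -> set T) :
  well_founded lt ->
  (forall s w, ~ E w `<=` s @` [set v | lt v w]) ->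
  exists s : W -> T, forall w, E w (s w) /\ forall v, lt v w -> s v <> s w.
Proof.
move=> ltwf nE.
pose step w (rec : forall v, lt v w -> T) :=
  xget point [set x | E w x /\ forall v vw, rec v vw <> x].
pose s := Fix ltwf (fun=> T) step.
have sE w : s w = step w (fun v _ => s v).
  rewrite /s Fix_eq // => x f g fg; congr (step x _).
  apply functional_extensionality_dep => v.
  by apply functional_extensionality_dep => vx; exact: fg.
exists s => w; rewrite sE.
apply: (@xgetPex _ point [set x | E w x /\ forall v, lt v w -> s v <> x]).
apply: contrapT => nex; apply: (nE s w) => x Ex; apply: contrapT => nx.
apply: nex; exists x; split=> // v vw vx; apply: nx.
by exists v.
Qed.

(** * Coding by finite lists and injective choice functions *)

(* For infinite [S] this means |S'| <= |S|; in this form it is transitive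
   without the cardinal arithmetic |S^{<omega} * omega| = |S|. *)
Definition finitely_coded {T T' : eqType} (S : set T) (S' : set T') : Prop :=
  exists code : seq T -> nat -> T',
    forall y, S' y -> exists l n, (forall x, x \in l -> S x) /\ code l n = y.

(** Each entry of the outer list is decoded from its own inner list. The inner lists are
    concatenated; their lengths and all numerical parameters are packed into one number. *)
Lemma finitely_coded_trans (T1 T2 T3 : eqType)
    (S1 : set T1) (S2 : set T2) (S3 : set T3) :
  finitely_coded S1 S2 -> finitely_coded S2 S3 -> finitely_coded S1 S3.
Proof.
move=> [c1 c1P] [c2 c2P].
pose c l n := if unpickle n is Some (sh, ns, m)
  then c2 [seq c1 p.1 p.2 | p <- zip (reshape sh l) ns] m else c2 [::] 0.
exists c => z /c2P[l2 [m [l2S <-]]].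
suff [ps psS <-] : exists2 ps : seq (seq T1 * nat),
    (forall p, p \in ps -> forall x, x \in p.1 -> S1 x) &
    [seq c1 p.1 p.2 | p <- ps] = l2.
  exists (flatten (unzip1 ps)),
    (pickle (shape (unzip1 ps), unzip2 ps, m)); split.
    by move=> x /flattenP[l /mapP[p /psS pS ->]]; exact: pS.
  by rewrite /c pickleK flattenK zip_unzip.
elim: l2 l2S => [|y l2 IH] l2S; first by exists [::].
have [|ps psS <-] := IH; first by move=> x xl; apply: l2S; rewrite inE xl orbT.
have [|l [n [lS <-]]] := c1P y; first by apply: l2S; rewrite mem_head.
exists ((l, n) :: ps) => // p; rewrite inE => /predU1P[->|/psS] //.
Qed.

Lemma finitely_coded_sub (T T' : eqType) (S1 S2 : set T) (S' : set T') :
  S1 `<=` S2 -> finitely_coded S1 S' -> finitely_coded S2 S'.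
Proof.
move=> S12 [c cP]; exists c => y /cP[l [n [lS <-]]].
by exists l, n; split=> // x /lS /S12.
Qed.

Lemma finitely_coded_refl (T : pointedType) (S : set T) : finitely_coded S S.
Proof.
exists (fun l _ => head point l) => y Sy; exists [:: y], 0; split=> // z.
by rewrite inE => /eqP->.
Qed.

Lemma finitely_coded_setU1 (T : eqType) (S : set T) (x : T) :
  finitely_coded S (x |` S).
Proof.
exists (fun l _ => head x l) => y [->|Sy]; first by exists [::], 0.
by exists [:: y], 0; split=> // z; rewrite inE => /eqP->.
Qed.

(** Greedy choice works along an order whose initial segments do not code [W], since every [E w]
    does. An arbitrary well-order is rearranged into such an order by coding [W] with its [small]
    points. *)
Lemma injective_choice (W T : pointedType) (E : W -> set T) :
    ~ finitely_coded (@set0 W) [set: W] ->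
    (forall w, finitely_coded (E w) [set: W]) ->
  exists2 s : W -> T, injective s & forall w, E w (s w).
Proof.
move=> W_uncountable E_codes.
have [lt [ltwf lttr lttot]] := strict_well_order W.
pose small u := ~ finitely_coded [set v | lt v u] [set: W].
have ltirr x : ~ lt x x.
  by elim/(well_founded_ind ltwf): x => x IH xx; exact: (IH x).
have W0 : [set: W] !=set0 by exists point.
(* With nothing above it, [u] and the points below it would make up [W]; otherwise the least [v]
   above [u] has no other predecessors. *)
have small_next u : small u -> exists2 v, lt u v & small v.
  move=> su.
  have [|v uv vmin] := @well_founded_minimum _ lt [set v | lt u v] ltwf.
    apply: contrapT => nex; apply: su.
    apply: finitely_coded_trans (finitely_coded_setU1 _ u) _.
    apply: (@finitely_coded_sub _ _ setT); last exact: finitely_coded_refl.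
    move=> v _; case: (lttot v u) => [vu|->|uv]; [by right|by left|].
    by case: nex; exists v.
  exists v => //; apply: contra_not su => cv.
  apply: finitely_coded_trans (finitely_coded_setU1 _ u) _.
  apply: finitely_coded_sub cv => t /= tv; case: (lttot t u) => [tu|->|ut].
  - by right.
  - by left.
  - by case: (vmin t).
(* Either all points are small, or the segment below the least point that is not small consists of
   small points and codes [W]. *)
have small_codes : finitely_coded small [set: W].
  have [nall|all_small] := pselect ([set v | ~ small v] !=set0).
    have [v nv vmin] := well_founded_minimum ltwf nall.
    apply: finitely_coded_sub (contrapT nv) => u uv.
    by apply: contrapT => nu; apply: (vmin u).
  apply: finitely_coded_sub (finitely_coded_refl _) => u _.
  by apply: contrapT => nu; apply: all_small; exists u.
have [c cP] := small_codes.
have bounded (l : seq W) : (forall x, x \in l -> small x) ->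
    exists2 v, small v & forall x, x \in l -> lt x v.
  elim: l => [_|x l IH lS].
    (* The empty list is bounded by the least point of [W], which is small because [W] is
       uncountable. *)
    have [v _ vmin] := well_founded_minimum ltwf W0.
    exists v => //; apply: contra_not W_uncountable; apply: finitely_coded_sub.
    by move=> u uv; exact: (vmin u uv Logic.I).
  have [|v sv vP] := IH; first by move=> y yl; apply: lS; rewrite inE yl orbT.
  have [|u xu su] := small_next x; first by apply: lS; rewrite mem_head.
  have [w sw [uw vw]] :
      exists2 w, small w & (lt u w \/ u = w) /\ (lt v w \/ v = w).
    case: (lttot u v) => [uv|uv|vu].
    - by exists v => //; split; [left|right].
    - by exists v => //; split; right.
    - by exists u => //; split; [right|left].
  exists w => // y; rewrite inE => /predU1P[->|/vP yv].
  - by case: uw => [/(lttr _ _ _ xu)|<-].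
  - by case: vw => [/(lttr _ _ _ yv)|<-].
(* Every [w] has a code below some small [m w].  If the points are ordered by
   [m] first, the initial segment of [w] is coded below [m w], hence its image
   under any [s] does not cover [E w]. *)
have /choice[m mP] w : exists v, small v /\
    exists l n, (forall x, x \in l -> lt x v) /\ c l n = w.
  have [l [n [lS <-]]] := cP w Logic.I.
  by have [v sv lv] := bounded l lS; exists v; split=> //; exists l, n.
pose prec v w := lt (m v) (m w) \/ m v = m w /\ lt v w.
have precwf : well_founded prec.
  suff accm u : forall w, m w = u -> Acc prec w.
    by move=> w; exact: (accm (m w)).
  elim/(well_founded_ind ltwf): u => u IHu w.
  elim/(well_founded_ind ltwf): w => w IHw mw; constructor => v.
  case=> [mvw|[mvw vw]]; first by apply: (IHu (m v)) => //; rewrite -mw.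
  by apply: IHw => //; rewrite mvw.
have prectot v w : v <> w -> prec v w \/ prec w v.
  rewrite /prec; case: (lttot (m v) (m w)) => [|mvw|]; try by auto.
  by case: (lttot v w) => [|//|]; auto.
have [|s sP] := @well_founded_choice _ T prec E precwf.
  move=> s w Es; have [smw _] := mP w; apply: smw.
  apply: finitely_coded_trans _ (E_codes w).
  exists (fun l n => s (c l n)) => _ /Es[v vw <-].
  have [_ [l [n [lv <-]]]] := mP v.
  exists l, n; split=> // x /lv xv.
  by case: vw => [/(lttr _ _ _ xv)|[<-]].
exists s => [v w svw|w]; last by case: (sP w).
apply: contrapT => vw; case: (prectot _ _ vw) => [vw'|wv].
- by have [_ /(_ _ vw')] := sP w.
- by have [_ /(_ _ wv)] := sP v; rewrite svw.
Qed.

(** * Infinite sets and the ideal of an AD family *)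

Lemma infinite_sequence (T : pointedType) (S : set T) :
  infinite_set S -> exists2 a : nat -> T, injective a & forall n, S (a n).
Proof.
move=> /infiniteP /ppcard_leP[a]; exists a => [m n amn|n].
  by apply: ('inj_a); rewrite ?inE.
exact: funS.
Qed.

Lemma injective_range_infinite (T U : Type) (a : T -> U) :
  injective a -> infinite_set [set: T] -> infinite_set (range a).
Proof.
move=> ainj; rewrite (eq_finite_set (inj_card_eq _)) //.
by move=> m n _ _; exact: ainj.
Qed.

Lemma infinite_meets_member (D : set nat) (V : set (set nat)) :
  infinite_set D -> finite_set V -> almost_subset D (\bigcup_(a in V) a) ->
  exists2 a, V a & infinite_set (D `&` a).
Proof.
move=> Dinf Vfin DV; apply: contrapT => nex; apply: Dinf.
have : finite_set (\bigcup_(a in V) (D `&` a)).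
  apply: bigcup_finite => // a Va; apply: contrapT => Da.
  by apply: nex; exists a.
rewrite -setI_bigcupr => DVfin.
by rewrite -(setUIDK D (\bigcup_(a in V) a)) finite_setU.
Qed.

Lemma AD_filterE (A : set (set nat)) (X : set nat) :
  AD_filter A X <-> AD_ideal A (~` X).
Proof.
split=> [[I AI <-]|AX]; first by rewrite setCK.
by exists (~` X) => //; rewrite setCK.
Qed.

Lemma RK_le_AD (A : set (set nat)) (F : set (set nat)) :
  RK_le (AD_filter A) F ->
  exists f : nat -> nat, forall Y, AD_ideal A Y <-> F (f @^-1` (~` Y)).
Proof.
move=> [f [_ AF]]; exists f => Y.
by rewrite -[Y in AD_ideal A Y]setCK -AD_filterE AF.
Qed.

Lemma AD_ideal_sub (A : set (set nat)) (X Y : set nat) :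
  X `<=` Y -> AD_ideal A Y -> AD_ideal A X.
Proof.
move=> XY [V [Vfin VA YV]]; exists V; split=> //.
by apply: sub_finite_set YV; exact: setSD.
Qed.

Lemma AD_ideal_bigcup (A V : set (set nat)) (X : set nat) :
  finite_set V -> V `<=` A -> X `<=` \bigcup_(a in V) a -> AD_ideal A X.
Proof.
move=> Vfin VA XV; exists V; split=> //.
by rewrite /almost_subset (_ : _ `\` _ = set0) //; rewrite setD_eq0.
Qed.

Lemma AD_ideal_member (A : set (set nat)) (a : set nat) : A a -> AD_ideal A a.
Proof.
move=> Aa; apply: (@AD_ideal_bigcup _ [set a]) => //.
- by move=> _ ->.
- by rewrite bigcup_set1.
Qed.

(** A member with infinite trace on [Y] meets some set of the finite cover [V] infinitely often, so
    it equals that set by almost disjointness. *)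
Lemma AD_ideal_infinite_trace (A : set (set nat)) (Y : set nat) :
  AD_family A -> AD_ideal A Y ->
  finite_set [set a | A a /\ infinite_set (a `&` Y)].
Proof.
move=> [_ _ AD] [V [Vfin VA YV]]; apply: sub_finite_set (Vfin) => a [Aa aY].
have [|b Vb abY] := infinite_meets_member aY Vfin.
  by apply: sub_finite_set YV => x [[]].
apply: contrapT => aV; apply: abY; apply: sub_finite_set (AD a b Aa _ _).
- by move=> x [[]].
- exact: VA.
- by move=> ab; rewrite ab in aV.
Qed.

Lemma partition_block_unique (P : set (set nat)) p q n :
  partition P id [set: nat] -> P p -> P q -> p n -> q n -> p = q.
Proof. by move=> [_ /(_ p q) + _] => + Pp Pq pn qn; apply=> //; exists n. Qed.

(** * FAN filters against filters of AD families *)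

(** Distinct members [a n] are thinned finitely so that each block meets only finitely many of their
    preimages. This puts the union [Y] into the ideal, although [Y] has infinite trace on every
    [a n]. *)
Lemma AD_filter_nle_FAN (A P : set (set nat)) :
  AD_family A -> partition P id [set: nat] ->
  ~ RK_le (AD_filter A) (FAN_filter P).
Proof.
move=> AD partP /RK_le_AD[f fP].
have fI Y p : P p -> AD_ideal A Y -> finite_set (p `&` f @^-1` Y).
  by move=> Pp /fP/(_ p Pp); rewrite /almost_subset preimage_setC setDE setCK.
have [Ainf _ _] := AD; have [a ainj aA] := infinite_sequence Ainf.
(* [b n] is the block containing [n]; this lists all blocks, with repetitions. *)
have /choice[b bP] n : exists p, P p /\ p n.
  by have [/seteqP[_ /(_ n Logic.I)[p Pp pn]] _ _] := partP; exists p.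
pose removed n := f @` \bigcup_(k in `I_n) (b k `&` f @^-1` a n).
have removed_fin n : finite_set (removed n).
  apply: finite_image; apply: bigcup_finite => // k _.
  by apply: fI; [case: (bP k)|exact: AD_ideal_member].
pose Y := \bigcup_n (a n `\` removed n).
have YA : AD_ideal A Y.
  apply/fP => p Pp; rewrite /almost_subset preimage_setC setDE setCK.
  have [_ _ /(_ p Pp)[k pk]] := partP.
  have {pk} -> : p = b k.
    by have [? ?] := bP k; exact: partition_block_unique partP _ _ pk _.
  apply: (@sub_finite_set _ _ (\bigcup_(n in `I_k.+1) (b k `&` f @^-1` a n))).
    move=> x [bx [n _ [anx nremoved]]]; exists n => //=.
    rewrite ltnS leqNgt; apply/negP => kn; apply: nremoved.
    by exists x => //; exists k.
  apply: bigcup_finite => // n _.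
  by apply: fI; [case: (bP k)|exact: AD_ideal_member].
apply: (injective_range_infinite ainj infinite_nat).
apply: sub_finite_set (AD_ideal_infinite_trace AD YA) => _ [n _ <-].
split=> //; have [_ + _] := AD => /(_ _ (aA n)) aninf.
apply: sub_infinite_set (infinite_setD aninf (removed_fin n)) => x [ax nx].
by split=> //; exists n.
Qed.

Lemma RK_le_to_AD (A : set (set nat)) (F : set (set nat)) :
  RK_le F (AD_filter A) ->
  exists f : nat -> nat, forall Y, F (~` Y) <-> AD_ideal A (f @^-1` Y).
Proof.
move=> [f [_ FA]]; exists f => Y.
by rewrite FA /= AD_filterE preimage_setC setCK.
Qed.

(** Selectors of the preimages of blocks are built successively, each avoiding the members of [A]
    that almost cover the earlier ones. The images of their tails meet each block finitely, yet no
    finite subfamily almost covers all tails. *)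
Lemma FAN_nle_AD_filter (A P : set (set nat)) :
  AD_family A -> partition_into_infinite_sets P ->
  ~ RK_le (FAN_filter P) (AD_filter A).
Proof.
move=> [_ _ AD] [partP Pinf pinf] /RK_le_to_AD[f fP].
have [p pinj pP] := infinite_sequence Pinf.
have pre_notin n : ~ AD_ideal A (f @^-1` p n).
  move=> /fP /(_ _ (pP n)); rewrite /almost_subset setDE setCK setIid.
  exact: pinf.
(* The range of a selector that avoids [V] is almost covered by finitely many
   members of [A], as its image meets each block of [P] in at most one point. *)
have escape (V : set (set nat)) : exists wU : (nat -> nat) * set (set nat),
    finite_set V -> V `<=` A ->
    [/\ forall n, p n (f (wU.1 n)), forall n, ~ (\bigcup_(a in V) a) (wU.1 n),
      finite_set wU.2, wU.2 `<=` A
      & almost_subset (range wU.1) (\bigcup_(a in wU.2) a)].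
  have [[Vfin VA]|nV] := pselect (finite_set V /\ V `<=` A); last first.
    by exists (id, V) => ? ?; case: nV.
  have /choice[w wP] n : exists x, p n (f x) /\ ~ (\bigcup_(a in V) a) x.
    apply: contrapT => nex; apply: (pre_notin n).
    apply: (AD_ideal_bigcup Vfin VA).
    by move=> x px; apply: contrapT => nx; apply: nex; exists x.
  have [U [Ufin UA wU]] : AD_ideal A (range w).
    apply: (@AD_ideal_sub _ _ (f @^-1` (range (f \o w)))).
      by move=> x [n _ <-]; exists n.
    apply/fP => q Pq; rewrite /almost_subset setDE setCK.
    have [[n qn]|nq] := pselect (exists n, q = p n).
      apply: (@sub_finite_set _ _ [set f (w n)]) => // y [qx [m _ /= mx]].
      suff -> : n = m by [].
      apply: pinj; rewrite -qn.
      apply: (partition_block_unique partP Pq (pP m) qx).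
      by rewrite -mx; case: (wP m).
    apply: (@sub_finite_set _ _ set0) => // y [qx [m _ /= mx]]; apply: nq.
    exists m; apply: (partition_block_unique partP Pq (pP m) qx).
    by rewrite -mx; case: (wP m).
  by exists (w, U) => _ _; split=> // n; case: (wP n).
have [g gP] := choice escape.
(* The selector [w k] avoids the union of [B k] and is almost covered by that of [B k.+1]. *)
pose B k := iter k (fun V => V `|` (g V).2) set0.
pose w k := (g (B k)).1.
have BP k : finite_set (B k) /\ B k `<=` A.
  elim: k => [|k [Bfin BA]]; first by split.
  have [_ _ gfin gA _] := gP _ Bfin BA.
  by split; [rewrite /= finite_setU|rewrite /= subUset].
have Bmono j k : j <= k -> B j `<=` B k.
  move=> /subnK <-; elim: (k - j) => [//|d IH] a /IH Ba.
  by left.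
have wp k n : p n (f (w k n)).
  by have [Bfin BA] := BP k; have [] := gP _ Bfin BA.
(* Almost covering all tails of the selectors [w k] requires a new member of [A]
   for each [k]. *)
pose Y := [set y | exists k n, k <= n /\ y = f (w k n)].
have [V [Vfin VA YV]] : AD_ideal A (f @^-1` Y).
  apply/fP => q Pq; rewrite /almost_subset setDE setCK.
  have [[n qn]|nq] := pselect (exists n, q = p n).
    (* In the block [p n] only the selectors with [k <= n] contribute, one point each. *)
    apply: (@sub_finite_set _ _ ((fun k => f (w k n)) @` `I_n.+1)).
      move=> x [qx [k [m [km mx]]]].
      suff nm : n = m by exists k; rewrite ?nm //= ltnS.
      apply: pinj; rewrite -qn.
      by apply: (partition_block_unique partP Pq (pP m) qx); rewrite mx.
    exact: finite_image.
  apply: (@sub_finite_set _ _ set0) => // x [qx [k [m [_ mx]]]]; apply: nq.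
  by exists m; apply: (partition_block_unique partP Pq (pP m) qx); rewrite mx.
have /choice[a aP] k : exists a, [/\ V a, B k.+1 a & ~ B k a].
  have [Bfin BA] := BP k; have [_ wB gfin gA wU] := gP _ Bfin BA.
  pose D := w k @` [set n | k <= n].
  have Dinf : infinite_set D.
    apply: (@sub_infinite_set _ (range (fun n => w k (n + k)))).
      by move=> _ [n _ <-]; exists (n + k) => //=; exact: leq_addl.
    apply: injective_range_infinite infinite_nat => m n /= mn.
    apply: (@addIn k); apply: pinj.
    by apply: (partition_block_unique partP (pP _) (pP _) (wp k _)); rewrite mn.
  have [|a Va Da] := infinite_meets_member Dinf Vfin.
    apply: sub_finite_set YV => _ [[n kn <-] nV]; split=> //.
    by exists k, n.
  have [|b Ub Dab] := infinite_meets_member Da gfin.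
    by apply: sub_finite_set wU => x [[[n _ <-] _] nx]; split=> //; exists n.
  have ab : a = b.
    apply: contrapT => nab; apply: Dab.
    apply: sub_finite_set (AD a b (VA _ Va) (gA _ Ub) nab).
    by move=> x [[]].
  have [_ [[n _ <-] an]] := infinite_setN0 Da.
  exists a; split=> //; first by right; rewrite ab.
  by move=> Ba; apply: (wB n); exists a.
suff ainj : injective a.
  apply: (injective_range_infinite ainj infinite_nat).
  by apply: sub_finite_set Vfin => _ [k _ <-]; case: (aP k).
have aneq j k : j < k -> a j <> a k.
  move=> jk ajk; have [_ _ []] := aP k.
  by apply: (Bmono j.+1 k jk); rewrite -ajk; case: (aP j).
move=> j k ajk; case: (ltngtP j k) => [/aneq|/aneq|//]; last by rewrite ajk.
by [].
Qed.

(** * Sizes of Baire and Cantor space *)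

Lemma card_le_finitely_coded (T T' : pointedType) (S : set T) (S' : set T') :
  (S' #<= S)%card -> finitely_coded S S'.
Proof.
move=> /ppcard_leP[g].
exists (fun l _ => xget point [set y | S' y /\ l = [:: g y]]) => y Sy.
exists [:: g y], 0; split; first by move=> _ /[!inE] /eqP->; exact: funS.
apply: xget_unique => [|z [Sz [gzy]]]; first by split.
by apply: ('inj_g); rewrite ?inE.
Qed.

(** Over the empty set only the empty list is available, so a code is a mere sequence, and the
    successors of its diagonal values escape it. *)
Lemma baire_uncountable :
  ~ finitely_coded (@set0 ((nat -> nat) * nat)%type) [set: (nat -> nat) * nat].
Proof.
move=> [c cP]; have [l [n [l0]]] :=
  cP (fun n => ((c [::] n).1 n).+1, 0) Logic.I.
case: l l0 => [_|x l /(_ x (mem_head _ _))//] cn.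
have /(congr1 (fun w => w.1 n)) /= := cn.
by move/eqP; rewrite -[X in X == _]addn0 -addn1 eqn_add2l.
Qed.

(** A pair becomes the indicator, on a disjoint sum, of the graph of its function and of the
    singleton of its number. *)
Lemma baire_card_le_cantor :
  ([set: (nat -> nat) * nat] #<= [set: nat -> bool])%card.
Proof.
pose code (w : (nat -> nat) * nat) n := match unpickle n with
  | Some (inl ij) => w.1 ij.1 == ij.2
  | Some (inr k) => w.2 == k
  | None => false end.
apply/pcard_injP; exists code => -[f k] [g l] _ _ /funeqP fg.
congr pair.
  apply/funext => i; apply/esym/eqP.
  have := fg (pickle (inl (i, f i) : (nat * nat) + nat)).
  by rewrite /code pickleK /= eqxx => <-.
apply/esym/eqP.
have := fg (pickle (inr k : (nat * nat) + nat)).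
by rewrite /code pickleK /= eqxx => <-.
Qed.

(** * Branches of the binary tree *)

Section Branches.
Variable e : seq bool -> nat.
Hypothesis e_inj : injective e.

Let B (x : nat -> bool) := e @` branch x.

Lemma branch_image_infinite x : infinite_set (B x).
Proof.
rewrite /B /branch image_comp.
apply: injective_range_infinite infinite_nat => m n /e_inj.
by move/(congr1 size); rewrite !size_mkseq.
Qed.

(** Nodes common to two branches that differ at [i] have length at most [i]. *)
Lemma branch_image_disjoint x y : infinite_set (B x `&` B y) -> x = y.
Proof.
apply: contra_notP => xy; have [i xyi] : exists i, x i <> y i.
  by apply: contrapT => nex; apply: xy; apply/funext => i;
    apply: contrapT => xyi; apply: nex; exists i.
apply: (@sub_finite_set _ _ ((fun n => e (mkseq x n)) @` `I_i.+1)); last first.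
  exact: finite_image.
move=> _ [[_ [n _ <-] <-] [_ [m _ <-] /e_inj ym]].
have mn : m = n by rewrite -(size_mkseq y m) ym size_mkseq.
exists n => //=; rewrite ltnS leqNgt; apply/negP => ni; apply: xyi.
by have /(congr1 (fun s => nth false s i)) := ym; rewrite mn !nth_mkseq.
Qed.

Lemma branch_image_inj : injective B.
Proof.
move=> x y xy; apply: branch_image_disjoint; rewrite xy setIid.
exact: branch_image_infinite.
Qed.

Lemma branch_family_AD (X : set (nat -> bool)) :
  infinite_set X -> AD_family (branch_family e X).
Proof.
move=> Xinf; split.
- rewrite /branch_family (eq_finite_set (inj_card_eq _)) //.
  by move=> x y _ _; exact: branch_image_inj.
- by move=> _ [x _ <-]; exact: branch_image_infinite.
- move=> _ _ [x _ <-] [y _ <-] xy; apply: contrapT => /branch_image_disjoint.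
  by move=> xy'; rewrite xy' in xy.
Qed.

(** A branch meets no other branch infinitely often, so every finite almost cover by branches
    contains it. The ideal therefore determines [X]. *)
Lemma branch_family_ideal_branch (X : set (nat -> bool)) (x : nat -> bool) :
  AD_ideal (branch_family e X) (B x) <-> X x.
Proof.
split=> [[V [Vfin VX xV]]|Xx]; last by apply: AD_ideal_member; exists x.
have [a /VX[y Xy <-]] :=
  infinite_meets_member (@branch_image_infinite x) Vfin xV.
by move=> /branch_image_disjoint ->.
Qed.

(** For [Y] the preimage of [a], this is the set D(a) of the outline. *)
Definition infinite_traces (Y : set nat) : set (nat -> bool) :=
  [set x | infinite_set (Y `&` B x)].

(** The branches with infinite trace occur in any finite almost cover, and an infinite remainder
    outside them would have infinite trace on a further branch. *)
Lemma infinite_traces_ideal (X : set (nat -> bool)) (Y : set nat) :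
  AD_ideal (branch_family e X) Y ->
  [/\ infinite_traces Y `<=` X, finite_set (infinite_traces Y)
    & almost_subset Y (\bigcup_(x in infinite_traces Y) B x)].
Proof.
move=> [V [Vfin VX YV]].
have trV x : infinite_traces Y x -> V (B x) /\ X x.
  move=> Yx; have [|a Va] := infinite_meets_member Yx Vfin.
    by apply: sub_finite_set YV => n [[]].
  have [y Xy ya] := VX _ Va; rewrite -ya in Va *.
  rewrite -setIA => xy.
  have -> // : x = y.
  by apply: branch_image_disjoint; apply: sub_infinite_set xy => n [].
split.
- by move=> x /trV[].
- have : finite_set (B @` infinite_traces Y).
    by apply: sub_finite_set Vfin => _ [x /trV[Vx _] <-].
  rewrite (eq_finite_set (inj_card_eq _)) // => x y _ _.
  exact: branch_image_inj.
- apply: contrapT => Dinf.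
  have [|a /VX[y _ <-] Dy] := infinite_meets_member Dinf Vfin.
    by apply: sub_finite_set YV => n [[]].
  have [n [[_ +] yn]] := infinite_setN0 Dy; apply; exists y => //.
  by apply: sub_infinite_set Dy => m [[]].
Qed.

(** * Reductions of [AD_filter A] to filters of branch families *)

Section Reduction.
Variables (A : set (set nat)) (f : nat -> nat) (X : set (nat -> bool)).
Hypothesis A_AD : AD_family A.
Hypothesis fP :
  forall Y, AD_ideal A Y <-> AD_ideal (branch_family e X) (f @^-1` Y).

Let E := \bigcup_(a in A) infinite_traces (f @^-1` a).

Lemma reduction_traces_sub : E `<=` X.
Proof.
move=> x [a Aa]; have /fP/infinite_traces_ideal[+ _ _] := AD_ideal_member Aa.
exact.
Qed.

Lemma reduction_fiber_finite (L : set (nat -> bool)) :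
  finite_set L -> L `<=` X ->
  finite_set [set a | A a /\ infinite_traces (f @^-1` a) `<=` L].
Proof.
move=> Lfin LX; set N := (X in finite_set X).
pose U := \bigcup_(x in L) B x.
(* Deleting from [a] the values that [f] takes outside [U] keeps the preimage of [M] inside [U].
   They are finitely many, because the branches in [L] almost cover the preimage of [a]. *)
pose M := \bigcup_(a in N) (a `\` f @` (f @^-1` a `\` U)).
have MA : AD_ideal A M.
  apply/fP; apply: (@AD_ideal_bigcup _ (B @` L)).
  - exact: finite_image.
  - by move=> _ [x Lx <-]; exists x => //; exact: LX.
  - rewrite bigcup_image => n [a _ [an nU]]; apply: contrapT => Un; apply: nU.
    by exists n.
apply: sub_finite_set (AD_ideal_infinite_trace A_AD MA) => a Na.
have [Aa aL] := Na.
split=> //; have [_ /(_ _ Aa) ainf _] := A_AD.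
have cfin : finite_set (f @` (f @^-1` a `\` U)).
  apply: finite_image.
  have /fP/infinite_traces_ideal[_ _] := AD_ideal_member Aa.
  apply: sub_finite_set => n [an nU]; split=> // -[x /aL Lx xn].
  by apply: nU; exists x.
apply: sub_infinite_set (infinite_setD ainf cfin) => n [an nn].
by split=> //; exists a.
Qed.

(** A member [a] is coded by the list of the branches on which its preimage has infinite trace and
    by its position among the finitely many members whose branches all lie in that list. *)
Lemma reduction_traces_code : finitely_coded E A.
Proof.
have /choice[s sP] (l : seq (nat -> bool)) : exists s : seq (set nat),
    (forall x, x \in l -> X x) ->
    [set a | A a /\ infinite_traces (f @^-1` a) `<=` [set` l]] = [set` s].
  have [lX|nl] := pselect (forall x, x \in l -> X x); last by exists [::].
  have /finite_seqP[s sE] : finite_set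
      [set a | A a /\ infinite_traces (f @^-1` a) `<=` [set` l]].
    by apply: reduction_fiber_finite => //; exact: finite_seq.
  by exists s.
exists (fun l n => nth set0 (s l) n) => a Aa.
have /fP/infinite_traces_ideal[trX /finite_seqP[l lE] _] := AD_ideal_member Aa.
have trl x : x \in l -> infinite_traces (f @^-1` a) x.
  by move=> xl; have : [set` l] x by []; rewrite -lE.
have al : a \in s l.
  suff : [set` s l] a by [].
  by rewrite -(sP l (fun x xl => trX x (trl x xl))); split; rewrite ?lE.
exists l, (index a (s l)); split; last exact: nth_index.
by move=> x /trl; exists a.
Qed.

End Reduction.
End Branches.

(** * Construction of [X] *)

Theorem theorem6p6 (e : seq bool -> nat) (he : bijective e)
    (P : set (set nat)) (hP : partition_into_infinite_sets P)
    (A : set (set nat)) (hA : NMAD_family A) (hsep : completely_separable A)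
    (hc : (A #= [set: nat -> bool])%card) :
  exists X : set (nat -> bool),
    [/\ infinite_set X,
        RK_incomparable (FAN_filter P) (AD_filter A),
        RK_incomparable (FAN_filter P) (AD_filter (branch_family e X))
      & RK_incomparable (AD_filter A) (AD_filter (branch_family e X))].
Proof.
have e_inj := bij_inj he; have A_AD := hA.1; have [partP _ _] := hP.
pose W := ((nat -> nat) * nat)%type.
have cantor_W : finitely_coded [set: nat -> bool] [set: W].
  exact: card_le_finitely_coded baire_card_le_cantor.
have A_W : finitely_coded A [set: W].
  apply: card_le_finitely_coded.
  by rewrite (card_le_eqr hc) baire_card_le_cantor.
pose E f := \bigcup_(a in A) infinite_traces e (f @^-1` a).
(* The fallback [setT] makes every value of [E'] large enough for the injective choice. *)
pose E' (w : W) :=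
  if `[< finitely_coded (E w.1) [set: W] >] then E w.1 else setT.
have [|s s_inj sE] := @injective_choice W (nat -> bool) E' baire_uncountable.
  by move=> w; rewrite /E'; case: ifPn => [/asboolP|].
pose X_of f : set (nat -> bool) :=
  [set x | AD_ideal A (f @^-1` (e @` branch x))].
(* The points [s (f, 1)] make [X] infinite, the points [s (f, 2)] stay outside, and [s (f, 0)] is in
   [X] exactly when it is not in [X_of f]. *)
pose X := [set x | exists f, x = s (f, 0) /\ ~ X_of f x \/ x = s (f, 1)].
have Xinf : infinite_set X.
  apply: (@sub_infinite_set _ (range (fun n => s (cst n, 1)))).
    by move=> _ [n _ <-]; exists (cst n); right.
  apply: injective_range_infinite infinite_nat => m n /s_inj[].
  by move/funeqP/(_ 0).
have X_AD := branch_family_AD e_inj Xinf.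
exists X; split=> //; split;
  try exact: FAN_nle_AD_filter; try exact: AD_filter_nle_FAN.
- move=> /RK_le_AD[f fP].
  have {}fP Y : AD_ideal A Y <-> AD_ideal (branch_family e X) (f @^-1` Y).
    by rewrite fP AD_filterE preimage_setC setCK.
  have EW : finitely_coded (E f) [set: W].
    exact: finitely_coded_trans (reduction_traces_code e_inj A_AD fP) A_W.
  (* As [E f] codes [W], it contains [s (f, 2)], which would therefore lie in [X]. *)
  have := sE (f, 2); rewrite /E' asboolT //=.
  move=> /(reduction_traces_sub e_inj fP).
  by move=> [g [[/s_inj[]]|/s_inj[]]].
- move=> /RK_le_to_AD[f fP].
  have {}fP Y : AD_ideal (branch_family e X) Y <-> AD_ideal A (f @^-1` Y).
    by rewrite -fP AD_filterE setCK.
  have XE x : X_of f x <-> X x.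
    by rewrite /X_of /= -fP branch_family_ideal_branch.
  have [sX|nsX] := pselect (X (s (f, 0))); last first.
    by apply: (nsX); exists f; left; split=> // /XE.
  have [g [[/s_inj[fg]]|/s_inj[]//]] := sX.
  by rewrite -fg => /XE.
Qed.
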